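(* Let $\widetilde{\mathcal{A}}\in\mathbb{R}^{(I_1+1)\times\dots\times(I_N+1)}$ be the hyperinterpolation coefficient tensor of a function $f$ on $[-1,1]^N$, and let $\widetilde{\mathcal{A}}_{\rm TCUR}=\mathcal{G}\times_1(\mathbf{C}_1\mathbf{U}_1^\dag)\times_2\dots\times_N(\mathbf{C}_N\mathbf{U}_N^\dag)$ be a TCUR approximation of it (both defined in the context). For a Tucker rank $\{R_1,\dots,R_N\}$ with $R_n<S_n$, $n=1,2,\dots,N$, let $\{\mathcal{S};\mathbf{V}_1,\dots,\mathbf{V}_N\}$ be obtained by applying the TCUR-to-Tucker conversion algorithm (described in the context) to $\widetilde{\mathcal{A}}_{\rm TCUR}$. Then $$\|\mathcal{S}\times_1\mathbf{V}_1\dots\times_N\mathbf{V}_N-\widetilde{\mathcal{A}}\|_F\leq \|\widetilde{\mathcal{A}}_{\rm TCUR}-\widetilde{\mathcal{A}}\|_F+\prod_{n=1}^N\|\mathbf{C}_n\mathbf{U}_n^\dag\|_2\sqrt{\sum_{n=1}^N\sum_{i=R_{n}+1}^{\widehat{I}_n}\sigma_{i}(\widetilde{\mathbf{A}}_{(n)})^2},$$ with $\widehat{I}_n=\min\{I_n+1,(I_1+1)\cdots(I_{n-1}+1)(I_{n+1}+1)\cdots (I_N+1)\}$.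
   Context: Hyperinterpolation coefficient tensor. For each $n=1,\dots,N$ let $w_n$ be a weight function on $[-1,1]$ and let $\{\Phi^{(n)}_{i}\}_{i\ge 1}$ be the orthonormal polynomials for the inner product $\int_{-1}^1 g h\,w_n\,dx$, with $\Phi^{(n)}_i$ of degree $i-1$. Let $I_n$ be a given polynomial degree, and let $\{x^{(n)}_{m}\}_{m=1}^{M_n}\subset[-1,1]$ and $\{w^{(n)}_m\}_{m=1}^{M_n}$ be the nodes and positive weights of a quadrature rule that integrates exactly against $w_n$ all polynomials of degree at most $2I_n$. For $1\le i_n\le I_n+1$, $$\widetilde a_{i_1\dots i_N}=\sum_{m_1=1}^{M_1}\dots\sum_{m_N=1}^{M_N} f(x^{(1)}_{m_1},\dots,x^{(N)}_{m_N})\,\Phi^{(1)}_{i_1}(x^{(1)}_{m_1})\cdots\Phi^{(N)}_{i_N}(x^{(N)}_{m_N})\,w^{(1)}_{m_1}\cdots w^{(N)}_{m_N},$$ and $\widetilde{\mathcal{A}}=[\widetilde a_{i_1\dots i_N}]$. Notation. Put $J_n=\prod_{m\ne n}(I_m+1)$. The mode-$n$ unfolding $\widetilde{\mathbf{A}}_{(n)}\in\mathbb{R}^{(I_n+1)\times J_n}$ has rows indexed by $i_n$ and columns indexed by the other indices (lower modes varying fastest). $\times_n$ is the mode-$n$ tensor-matrix product. $\dag$ is the Moore–Penrose pseudoinverse, $\|\cdot\|_2$ the spectral norm, $\|\cdot\|_F$ the Frobenius norm, $\sigma_i$ the $i$th largest singular value. TCUR. $\mathbb{I}_n\subset\{1,\dots,I_n+1\}$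 with $|\mathbb{I}_n|=S_n<I_n+1$, $\mathbb{J}_n\subset\{1,\dots,J_n\}$ with $|\mathbb{J}_n|=S_n'<J_n$, $\mathcal{G}=\widetilde{\mathcal{A}}(\mathbb{I}_1,\dots,\mathbb{I}_N)\in\mathbb{R}^{S_1\times\dots\times S_N}$, $\mathbf{C}_n=\widetilde{\mathbf{A}}_{(n)}(:,\mathbb{J}_n)$, $\mathbf{U}_n=\mathbf{C}_n(\mathbb{I}_n,:)$ (restrictions to index sets). TCUR-to-Tucker conversion algorithm. Input: $\{\mathcal{G};\mathbf{C}_1\mathbf{U}_1^\dag,\dots,\mathbf{C}_N\mathbf{U}_N^\dag\}$ and target ranks $R_n<S_n$. (1) Compute economy-size QR factorizations $\mathbf{C}_n\mathbf{U}_n^\dag=\mathbf{Q}_n\mathbf{R}_n$ (orthonormal columns in $\mathbf{Q}_n\in\mathbb{R}^{(I_n+1)\times S_n}$), $n=1,\dots,N$. (2) Form $\widehat{\mathcal{G}}=\mathcal{G}\times_1\mathbf{R}_1\dots\times_N\mathbf{R}_N$. (3) Compute $\{\mathcal{S},\widehat{\mathbf{V}}_1,\dots,\widehat{\mathbf{V}}_N\}=\text{ST-HOSVD}(\widehat{\mathcal{G}};R_1,\dots,R_N)$: start with $\mathcal{S}:=\widehat{\mathcal{G}}$ and for $n=1,\dots,N$ let $\widehat{\mathbf{V}}_n\in\mathbb{R}^{S_n\times R_n}$ consist of the first $R_n$ left singular vectors of the mode-$n$ unfolding of the current $\mathcal{S}$ and replace $\mathcal{S}$ by $\mathcal{S}\times_n\widehat{\mathbf{V}}_n^\top$.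 (4) Set $\mathbf{V}_n=\mathbf{Q}_n\widehat{\mathbf{V}}_n$. *)

(* Defs.v *)
From HB Require Import structures.
From mathcomp Require Export all_boot all_order all_algebra.
From mathcomp Require Export all_classical all_reals all_analysis.
Export Order.TTheory GRing.Theory Num.Theory.
Export numFieldNormedType.Exports.

Set Implicit Arguments.
Unset Strict Implicit.
Unset Printing Implicit Defensive.

#[export] Set Implicit Arguments.
#[export] Unset Strict Implicit.
#[export] Unset Printing Implicit Defensive.

Local Open Scope classical_set_scope.
Local Open Scope ring_scope.

(* All indices (modes, tensor entries, polynomials, singular values) start
   at 0.  In particular [Phi i] below has degree [i]. *)

Section Quadrature.
Variable R : realType.
Implicit Types w : R -> R.

(* Integrability of [w] on the bounded interval is finiteness of all its
   moments; a positive integral makes the form below positive definite on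
   polynomials.  The values of [w] at single points, e.g. the endpoints for
   Chebyshev weights, do not matter to the integrals. *)
Definition weight_function w : Prop :=
  [/\ forall x, x \in `[-1, 1] -> 0 <= w x,
      lebesgue_measure.-integrable `[-1, 1] (EFin \o w)
    & 0 < \int[lebesgue_measure]_(x in `[-1, 1]) w x].

Definition weighted_inner w (g h : R -> R) : R :=
  \int[lebesgue_measure]_(x in `[-1, 1]) (g x * h x * w x).

(* The sign of the leading coefficients is left free. *)
Definition orthonormal_polys w (Phi : nat -> {poly R}) : Prop :=
  (forall i, size (Phi i) = i.+1) /\
  (forall i j,
     weighted_inner w (horner (Phi i)) (horner (Phi j)) = (i == j)%:R).

Definition quadrature_rule w (D M : nat) (x q : 'I_M -> R) : Prop :=
  [/\ forall m, x m \in `[-1, 1],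
      forall m, 0 < q m
    & forall p : {poly R}, (size p <= D.+1)%N ->
        \sum_m q m * p.[x m]
          = \int[lebesgue_measure]_(t in `[-1, 1]) (p.[t] * w t)].

End Quadrature.

Section Matrices.
Variable R : realType.

Definition vec_norm2 n (v : 'cV[R]_n) : R := Num.sqrt (\sum_i v i 0 ^+ 2).

Definition spectral_norm m n (A : 'M[R]_(m, n)) : R :=
  sup [set vec_norm2 (A *m v) | v in [set v : 'cV[R]_n | vec_norm2 v <= 1]].

(* The four Penrose equations, which have exactly one solution [X].
   ([pinvmx] is only a generalized inverse.) *)
Definition moore_penrose m n (A : 'M[R]_(m, n)) (X : 'M[R]_(n, m)) : Prop :=
  [/\ A *m X *m A = A,
      X *m A *m X = X,
      (A *m X)^T = A *m X
    & (X *m A)^T = X *m A].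

(* Full singular value decomposition.  Only the entries of [s] of index less
   than [minn m n] are meaningful. *)
Definition is_svd m n (A : 'M[R]_(m, n))
    (U : 'M[R]_m) (s : nat -> R) (W : 'M[R]_n) : Prop :=
  [/\ U^T *m U = 1%:M,
      W^T *m W = 1%:M,
      forall i, (i < minn m n)%N -> 0 <= s i,
      forall i j, (i <= j < minn m n)%N -> s j <= s i
    & A = U *m (\matrix_(i, j) (if i == j :> nat then s i else 0)) *m W^T].

Definition singular_values m n (A : 'M[R]_(m, n)) (s : nat -> R) : Prop :=
  exists U W, is_svd A U s W.

(* Meant for [r <= m].  The left singular vectors are the columns of an
   orthogonal matrix of order [m], so [r] may exceed [n]. *)
Definition leading_left_singular_vectors m n r
    (A : 'M[R]_(m, n)) (V : 'M[R]_(m, r)) : Prop :=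
  exists U s W, is_svd A U s W /\
    forall (i : 'I_m) (j : 'I_r) (k : 'I_m), k = j :> nat -> V i j = U i k.

Definition economy_qr m n (A : 'M[R]_(m, n))
    (Q : 'M[R]_(m, n)) (T : 'M[R]_n) : Prop :=
  [/\ A = Q *m T,
      Q^T *m Q = 1%:M
    & forall i j : 'I_n, (j < i)%N -> T i j = 0].

End Matrices.

Definition multi_index N (d : 'I_N -> nat) := {dffun forall n : 'I_N, 'I_(d n)}.

Definition tensor (R : Type) N (d : 'I_N -> nat) := {ffun multi_index d -> R}.

Section Unfolding.
Variables (N : nat) (d : 'I_N -> nat) (n : 'I_N).

Definition unfold_cols : nat := (\prod_(m < N | m != n) d m)%N.

(* Number of columns skipped when the index of mode [m] increases by one. *)
Definition unfold_stride (m : 'I_N) : nat :=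
  (\prod_(k < N | (k < m)%N && (k != n)) d k)%N.

Definition unfold_nat (i j : nat) (m : 'I_N) : nat :=
  if m == n then i else ((j %/ unfold_stride m) %% d m)%N.

Lemma unfold_nat_lt (i : 'I_(d n)) (j : 'I_unfold_cols) (m : 'I_N) :
  (unfold_nat i j m < d m)%N.
Proof.
rewrite /unfold_nat; case: eqP => [->//|/eqP mn].
rewrite ltn_mod lt0n; apply/negP => /eqP d0.
by have := ltn_ord j; rewrite {2}/unfold_cols (bigD1 m) //= d0 mul0n.
Qed.

(* The index of the entry in row [i] and column [j] of the mode-[n]
   unfolding: [j] is written in mixed radix over the modes other than [n],
   lower modes varying fastest. *)
Definition unfold_index (i : 'I_(d n)) (j : 'I_unfold_cols) : multi_index d :=
  finfun (fun m => Ordinal (unfold_nat_lt i j m)).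

End Unfolding.

Definition unfolding (R : Type) N (d : 'I_N -> nat) (n : 'I_N)
    (A : tensor R d) : 'M[R]_(d n, unfold_cols d n) :=
  \matrix_(i, j) A (unfold_index i j).

Section ModeProduct.
Variables (R : realType) (N : nat).
Implicit Types d : 'I_N -> nat.

Definition tensor_norm d (A : tensor R d) : R := Num.sqrt (\sum_i A i ^+ 2).

(* A x_n B, where the dimensions [d] of [A] and [d'] of the result are
   expected to differ in mode [n] only: the sum runs over the [k] that agree
   with [i] in all other modes, that is, over the [n]-th component of [k]. *)
Definition mode_product d d' (n : 'I_N) (A : tensor R d)
    (B : 'M[R]_(d' n, d n)) : tensor R d' :=
  [ffun i : multi_index d' =>
     \sum_(k : multi_index d | [forall m, (m != n) ==> (k m == i m :> nat)])
        B (i n) (k n) * A k].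

(* The dimensions once the modes below [k] have been changed from [d] to
   [d']. *)
Definition mid_dims d d' (k : nat) (m : 'I_N) : nat :=
  if (m < k)%N then d' m else d m.

Lemma mid_dims_before d d' (n : 'I_N) : mid_dims d d' n n = d n.
Proof. by rewrite /mid_dims ltnn. Qed.

Lemma mid_dims_after d d' (n : 'I_N) : mid_dims d d' n.+1 n = d' n.
Proof. by rewrite /mid_dims ltnS leqnn. Qed.

Lemma mid_dims_full d d' (n : 'I_N) : mid_dims d d' N n = d' n.
Proof. by rewrite /mid_dims ltn_ord. Qed.

Definition mode_product_step d d' (n : 'I_N)
    (A : tensor R (mid_dims d d' n)) (B : 'M[R]_(d' n, d n)) :
    tensor R (mid_dims d d' n.+1) :=
  mode_product A
    (castmx (esym (mid_dims_after d d' n), esym (mid_dims_before d d' n)) B).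

(* A x_0 B_0 ... x_(k-1) B_(k-1), for [k <= N]. *)
Fixpoint mode_products d d' (A : tensor R d)
    (B : forall n, 'M[R]_(d' n, d n)) (k : nat) : tensor R (mid_dims d d' k) :=
  match k return tensor R (mid_dims d d' k) with
  | 0 => A
  | k'.+1 =>
      match @idP (k' < N)%N with
      | ReflectT lt_k'N =>
          let n := Ordinal lt_k'N in
          mode_product_step (n := n) (mode_products A B k') (B n)
      | ReflectF _ => [ffun=> 0]
      end
  end.

(* A x_0 B_0 ... x_(N-1) B_(N-1) *)
Definition tucker d d' (A : tensor R d)
    (B : forall n, 'M[R]_(d' n, d n)) : tensor R d' :=
  [ffun i : multi_index d' =>
     mode_products A B N
       (finfun (fun n => cast_ord (esym (mid_dims_full d d' n)) (i n)))].

End ModeProduct.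

Section Algorithms.
Variables (R : realType) (N : nat).
Implicit Types d r s : 'I_N -> nat.

(* The current core when mode [n] is processed is the original tensor
   multiplied in the modes below [n] by the transposed factors. *)
Definition st_hosvd d r (A : tensor R d)
    (S : tensor R r) (V : forall n, 'M[R]_(d n, r n)) : Prop :=
  (forall n : 'I_N,
     leading_left_singular_vectors
       (unfolding n (mode_products A (fun m => (V m)^T) n))
       (castmx (esym (mid_dims_before d r n), erefl) (V n))) /\
  S = tucker A (fun m => (V m)^T).

Definition tcur_to_tucker d s r (G : tensor R s)
    (B : forall n, 'M[R]_(d n, s n))
    (S : tensor R r) (V : forall n, 'M[R]_(d n, r n)) : Prop :=
  exists (Q : forall n, 'M[R]_(d n, s n)) (T : forall n, 'M[R]_(s n))
         (V' : forall n, 'M[R]_(s n, r n)),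
    [/\ forall n, economy_qr (B n) (Q n) (T n),
        st_hosvd (tucker G T) S V'
      & forall n, V n = Q n *m V' n].

End Algorithms.

Section TCUR.
Variables (R : realType) (N : nat) (d : 'I_N -> nat).

(* [enum_val] lists the elements of a set of ordinals in increasing order. *)
Definition subtensor (A : tensor R d) (I : forall n, {set 'I_(d n)}) :
    tensor R (fun n => #|I n|) :=
  [ffun i : multi_index (fun n => #|I n|) =>
     A (finfun (fun n => enum_val (i n)))].

Definition tcur_C (A : tensor R d)
    (J : forall n, {set 'I_(unfold_cols d n)}) (n : 'I_N) :
    'M[R]_(d n, #|J n|) :=
  colsub (fun j : 'I_#|J n| => enum_val j) (unfolding n A).

Definition tcur_U (A : tensor R d) (I : forall n, {set 'I_(d n)})
    (J : forall n, {set 'I_(unfold_cols d n)}) (n : 'I_N) :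
    'M[R]_(#|I n|, #|J n|) :=
  rowsub (fun i : 'I_#|I n| => enum_val i) (tcur_C A J n).

End TCUR.

Definition hyperinterpolation_coeffs (R : realType) (N : nat)
    (I M : 'I_N -> nat) (f : 'rV[R]_N -> R) (Phi : 'I_N -> nat -> {poly R})
    (x q : forall n, 'I_(M n) -> R) : tensor R (fun n => (I n).+1) :=
  [ffun i : multi_index (fun n => (I n).+1) =>
     \sum_(m : multi_index M)
        f (\row_n x n (m n)) * (\prod_n (Phi n (i n)).[x n (m n)])
          * \prod_n q n (m n)].

(* Main.v *)
Require Import Defs.
From mathcomp Require Import ring lra.

Local Open Scope ring_scope.

(** By the triangle inequality it is enough to bound the distance from the
    Tucker tensor [S x V] to [A_TCUR].  Both are images under the factors [Q n],
    which have orthonormal columns, of [S x V'] and of the tensor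
    [G x T] fed to the sequentially truncated HOSVD; so their distance is the
    truncation error in the small dimensions.

    That truncation is an orthogonal projection, hence its squared error is the
    sum over the modes of the squared norm lost at each step
    ([st_hosvd_error]).  The step in mode [n] keeps the leading left singular
    vectors of the current unfolding, and so loses at most the squared distance
    from the current core to any tensor of mode-[n] rank at most [r n]
    ([ky_fan], [st_hosvd_step_le]).  The current core is the image of [A] under
    selection of entries, multiplication by the triangular factors [T m], and
    multiplication by some of the transposed factors of the truncation.
    Selections and transposed orthonormal factors are contractions, and
    multiplying by [T m] has the same norm as multiplying by
    [CU m = Q m *m T m].  Comparing the core with the image, under this same
    map, of the best approximation of [A] of mode-[n] rank [r n] bounds the loss
    by [\prod_m spectral_norm (CU m) ^+ 2] times the tail of the squared
    singular values of [unfolding n A] ([st_hosvd_image_error], [svd_tail]).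

    Iterated mode products pass through changing dimensions; they are handled by
    rewriting them as a closed multilinear formula ([multilin]), which composes
    factor by factor and whose adjoint has the transposed factors. *)

(** * Frobenius norms and orthogonal projectors *)

Lemma mxtraceB (R : pzRingType) n (X Y : 'M[R]_n) :
  \tr (X - Y) = \tr X - \tr Y.
Proof. exact: (raddfB (@mxtrace R n)). Qed.

Section Frobenius.
Variable R : realType.

Definition frob2 m n (X : 'M[R]_(m, n)) : R := \sum_i \sum_j X i j ^+ 2.

Lemma frob2E m n (X : 'M[R]_(m, n)) : frob2 X = \tr (X *m X^T).
Proof.
apply: eq_bigr => i _; rewrite mxE; apply: eq_bigr => j _.
by rewrite mxE expr2.
Qed.

Lemma frob2_ge0 m n (X : 'M[R]_(m, n)) : 0 <= frob2 X.
Proof. by apply: sumr_ge0 => i _; apply: sumr_ge0 => j _; exact: sqr_ge0. Qed.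

Lemma frob2_tr m n (X : 'M[R]_(m, n)) : frob2 X^T = frob2 X.
Proof. by rewrite !frob2E trmxK mxtrace_mulC. Qed.

Lemma frob2_col m n (X : 'M[R]_(m, n)) : frob2 X = \sum_j frob2 (col j X).
Proof.
rewrite /frob2 exchange_big; apply: eq_bigr => j _; apply: eq_bigr => i _.
by rewrite big_ord1 mxE.
Qed.

Lemma frob2_isometry m n p (Q : 'M[R]_(m, n)) (X : 'M[R]_(n, p)) :
  Q^T *m Q = 1%:M -> frob2 (Q *m X) = frob2 X.
Proof.
by move=> QQ; rewrite -frob2_tr -[RHS]frob2_tr !frob2E !trmxK trmx_mul -mulmxA
  (mulmxA Q^T) QQ mul1mx.
Qed.

(** Pythagoras: [X - Z *m X] and [Z *m X] are orthogonal, the cross traces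
    cancel by [Z *m Z = Z]. *)
Lemma frob2_projector m n (Z : 'M[R]_m) (X : 'M[R]_(m, n)) :
  Z^T = Z -> Z *m Z = Z -> frob2 (X - Z *m X) = frob2 X - frob2 (Z *m X).
Proof.
move=> Zt ZZ; rewrite !frob2E.
have -> : (X - Z *m X)^T = X^T - X^T *m Z by rewrite linearB /= trmx_mul Zt.
rewrite trmx_mul Zt mulmxBl !mulmxBr !mulmxA !mxtraceB.
have -> : \tr (Z *m X *m X^T *m Z) = \tr (Z *m X *m X^T).
  by rewrite mxtrace_mulC !mulmxA ZZ.
have -> : \tr (X *m X^T *m Z) = \tr (Z *m X *m X^T).
  by rewrite mxtrace_mulC mulmxA.
by rewrite subrr subr0.
Qed.

Lemma frob2_projector_le m n (Z : 'M[R]_m) (X : 'M[R]_(m, n)) :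
  Z^T = Z -> Z *m Z = Z -> frob2 (Z *m X) <= frob2 X.
Proof.
by move=> Zt ZZ; rewrite -subr_ge0 -(frob2_projector X Zt ZZ) frob2_ge0.
Qed.

(** Since [Z] fixes [Y], the left side is the squared norm of
    [(1 - Z) (X - Y)]: no matrix with range in that of [Z] is closer to [X] than
    [Z *m X]. *)
Lemma frob2_residual_le m n (Z : 'M[R]_m) (X Y : 'M[R]_(m, n)) :
  Z^T = Z -> Z *m Z = Z -> Z *m Y = Y ->
  frob2 X - frob2 (Z *m X) <= frob2 (X - Y).
Proof.
move=> Zt ZZ ZY; rewrite -frob2_projector //.
have -> : X - Z *m X = (X - Y) - Z *m (X - Y).
  by rewrite mulmxBr ZY opprB addrA subrK.
by rewrite frob2_projector // lerBlDr lerDl frob2_ge0.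
Qed.

(** Multiplying by [Q] does not change the norm, and [Q *m Q^T] is an orthogonal
    projector. *)
Lemma frob2_coisometry_le m n p (Q : 'M[R]_(m, n)) (X : 'M[R]_(m, p)) :
  Q^T *m Q = 1%:M -> frob2 (Q^T *m X) <= frob2 X.
Proof.
move=> QQ; rewrite -(frob2_isometry (Q^T *m X) QQ) mulmxA.
apply: frob2_projector_le; first by rewrite trmx_mul trmxK.
by rewrite -mulmxA (mulmxA Q^T) QQ mul1mx.
Qed.

(** Gram-Schmidt, adding one column at a time: the component [v] of the new
    column orthogonal to the range so far contributes the rank-one projector
    [v v^T / |v|^2], of trace 1.  Having [\tr Z <= r] in place of a rank bound
    is all that Ky Fan's inequality asks for. *)
Lemma range_projector m r (L : 'M[R]_(m, r)) :
  exists Z : 'M[R]_m,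
    [/\ Z^T = Z, Z *m Z = Z, Z *m L = L & \tr Z <= r%:R].
Proof.
elim: r => [|r IH] in L *.
  exists 0; split; rewrite ?trmx0 ?mul0mx ?mxtrace0 //.
  by rewrite [RHS]thinmx0.
pose l := lsubmx (L : 'M[R]_(m, 1 + r)).
pose L' := rsubmx (L : 'M[R]_(m, 1 + r)).
have LE : L = row_mx l L' by rewrite hsubmxK.
have [Z [Zt ZZ ZL trZ]] := IH L'.
pose v := l - Z *m l.
have Zv : Z *m v = 0 by rewrite mulmxBr mulmxA ZZ subrr.
have vZ : v^T *m Z = 0 by rewrite -Zt -trmx_mul Zv trmx0.
have [v0|v0] := eqVneq v 0.
  exists Z; split=> //; last by rewrite (le_trans trZ) // ler_nat.
  have Zl : Z *m l = l by apply/esym/eqP; rewrite -subr_eq0 -/v v0.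
  by rewrite LE [LHS](mul_mx_row Z l L') ZL Zl.
pose c := frob2 v.
have c0 : c != 0.
  apply: contra v0; rewrite psumr_eq0 => [/allP h|i _]; last first.
    by apply: sumr_ge0 => j _; exact: sqr_ge0.
  apply/eqP/matrixP => i j; have := h i (mem_index_enum _).
  by rewrite big_ord1 sqrf_eq0 (ord1 j) [RHS]mxE => /eqP.
have vv : v^T *m v = c%:M.
  by rewrite [LHS]mx11_scalar -[(_ *m _) 0 0]trace_mx11 mxtrace_mulC -frob2E.
pose Z' := Z + c^-1 *: (v *m v^T); exists Z'; split.
- by rewrite linearD linearZ /= trmx_mul trmxK Zt.
- rewrite mulmxDl !mulmxDr ZZ -!scalemxAl -!scalemxAr mulmxA Zv mul0mx scaler0.
  rewrite addr0 -mulmxA vZ mulmx0 scaler0 add0r; congr (_ + _ *: _).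
  rewrite -[v *m v^T *m _]mulmxA (mulmxA v^T) vv mul_scalar_mx -scalemxAr.
  by rewrite scalerA mulVf // scale1r.
- have vL' : v^T *m L' = 0 by rewrite -ZL mulmxA vZ mul0mx.
  have vl : v^T *m l = c%:M.
    rewrite -vv -[l in LHS](subrK (Z *m l)) -/v mulmxDr mulmxA vZ.
    by rewrite mul0mx addr0.
  have Z'L : Z' *m L' = L'.
    by rewrite mulmxDl ZL -scalemxAl -mulmxA vL' mulmx0 scaler0 addr0.
  have Z'l : Z' *m l = l.
    rewrite mulmxDl -scalemxAl -mulmxA vl mul_mx_scalar scalerA mulVf //.
    by rewrite scale1r addrC subrK.
  by rewrite LE [LHS](mul_mx_row Z' l L') Z'L Z'l.
- rewrite mxtraceD mxtraceZ -frob2E -/c mulVf // -addn1 natrD lerD2r //.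
Qed.

End Frobenius.

(** * Truncated singular value decompositions *)

Section SingularValues.
Variable R : realType.

Definition left_frame m r (h : (r <= m)%N) (U : 'M[R]_m) : 'M[R]_(m, r) :=
  colsub (widen_ord h) U.

(** The eigenvalues of [X *m X^T] when [s] are the singular values of
    [X : 'M_(m, n)]; for [n < m] they are padded with zeros, where [s] is
    unconstrained. *)
Definition sq_sigma m n (s : nat -> R) (i : nat) : R :=
  if (i < minn m n)%N then s i ^+ 2 else 0.

Lemma sq_sigma_ge0 m n s i : 0 <= sq_sigma m n s i.
Proof. by rewrite /sq_sigma; case: ifP => // _; exact: sqr_ge0. Qed.

Lemma frob2_col_frame m r (h : (r <= m)%N) (U : 'M[R]_m) (i : 'I_m) :
  U^T *m U = 1%:M ->
  frob2 ((left_frame h U)^T *m col i U) = (i < r)%N%:R.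
Proof.
move=> UU.
have E k : ((left_frame h U)^T *m col i U) k 0 = (k == i :> nat)%:R.
  have <- : (U^T *m U) (widen_ord h k) i = (k == i :> nat)%:R.
    by rewrite UU mxE.
  by rewrite !mxE; apply: eq_bigr => l _; rewrite !mxE.
rewrite /frob2; under eq_bigr do rewrite big_ord1 E.
have [ir|ri] := ltnP i r.
  rewrite (bigD1 (Ordinal ir)) //= eqxx expr1n big1 ?addr0 // => k.
  by rewrite -val_eqE /= => /negPf ->; rewrite expr0n.
rewrite big1 // => k _; case: eqP => [ki|]; last by rewrite expr0n.
by have := ltn_ord k; rewrite ki ltnNge ri.
Qed.

Lemma left_frame_orthonormal m r (h : (r <= m)%N) (U : 'M[R]_m) :
  U^T *m U = 1%:M -> (left_frame h U)^T *m left_frame h U = 1%:M.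
Proof.
move=> UU; apply/matrixP => i j.
have <- : (U^T *m U) (widen_ord h i) (widen_ord h j) = (1%:M : 'M[R]_r) i j.
  by rewrite UU !mxE.
by rewrite !mxE; apply: eq_bigr => k _; rewrite !mxE.
Qed.

Lemma frob2_orthogonal_col m (U : 'M[R]_m) (i : 'I_m) :
  U^T *m U = 1%:M -> frob2 (col i U) = 1.
Proof.
move=> UU; have <- : (U^T *m U) i i = 1 by rewrite UU mxE eqxx.
by rewrite mxE; apply: eq_bigr => k _; rewrite big_ord1 !mxE expr2.
Qed.

Lemma svd_gram m n (s : nat -> R) :
  let Sig := (\matrix_(i, j) (if i == j :> nat then s i else 0)) : 'M[R]_(m, n)
  in Sig *m Sig^T = diag_mx (\row_i sq_sigma m n s i).
Proof.
move=> Sig; apply/matrixP => i k; rewrite !mxE /sq_sigma leq_min ltn_ord /=.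
have [jn|nj] := ltnP i n; last first.
  rewrite mul0rn big1 // => j _; rewrite !mxE.
  case: eqP => [ij|]; last by rewrite mul0r.
  by have := ltn_ord j; rewrite -ij ltnNge nj.
rewrite (bigD1 (Ordinal jn)) //= big1 ?addr0 => [|j]; last first.
  by rewrite -val_eqE !mxE /= eq_sym => /negPf ->; rewrite mul0r.
rewrite !mxE /= eqxx eq_sym -(val_eqE i k); case: eqP => [->|] /=.
  by rewrite expr2.
by rewrite mulr0.
Qed.

(** Everything about truncations reduces to this formula: [B] enters only
    through its action on each left singular vector. *)
Lemma frob2_svd m n p (X : 'M[R]_(m, n)) U s W (B : 'M[R]_(p, m)) :
  is_svd X U s W ->
  frob2 (B *m X) = \sum_(i < m) sq_sigma m n s i * frob2 (B *m col i U).
Proof.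
case=> UU WW _ _ ->; set Sig := (\matrix_(i, j) _).
rewrite mulmxA -frob2_tr trmx_mul trmxK frob2_isometry // frob2_tr mulmxA.
rewrite frob2E trmx_mul mulmxA -(mulmxA _ Sig) svd_gram mul_mx_diag.
rewrite mxtrace_mulC; apply: eq_bigr => i _.
rewrite mxE /frob2 mulr_sumr; apply: eq_bigr => k _.
rewrite big_ord1 !mxE mulrA mulrC expr2.
by congr (_ * (_ * _)); apply: eq_bigr => j _; rewrite mxE.
Qed.

Lemma frob2_svd_frame m n r (h : (r <= m)%N) (X : 'M[R]_(m, n)) U s W :
  is_svd X U s W ->
  frob2 ((left_frame h U)^T *m X) = \sum_(i < m) sq_sigma m n s i * (i < r)%:R.
Proof.
move=> svd; rewrite (frob2_svd _ svd); apply: eq_bigr => i _.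
by case: svd => UU _ _ _ _; rewrite frob2_col_frame.
Qed.

Lemma svd_tail m n r (h : (r <= m)%N) (X : 'M[R]_(m, n)) U s W :
  is_svd X U s W -> let P := left_frame h U *m (left_frame h U)^T in
  frob2 (X - P *m X) = \sum_(r <= i < minn m n) s i ^+ 2.
Proof.
move=> svd P; have UU : U^T *m U = 1%:M by case: svd.
have VV := left_frame_orthonormal h UU.
rewrite frob2_projector ?trmx_mul ?trmxK //; last first.
  by rewrite mulmxA -(mulmxA _ _^T) VV mulmx1.
rewrite -mulmxA frob2_isometry // (frob2_svd_frame _ svd).
rewrite -[X in frob2 X]mul1mx (frob2_svd _ svd) -sumrB.
rewrite big_geq_mkord /=.
rewrite (big_ord_widen_cond m (leq r) (fun i => s i ^+ 2)) ?geq_minl //.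
rewrite [RHS]big_mkcond.
apply: eq_bigr => i _ /=.
rewrite mul1mx frob2_orthogonal_col // mulr1 /sq_sigma.
by case: (leqP r i) => /= _; case: ifP; rewrite ?mulr0 ?mulr1 ?subr0 ?subrr.
Qed.

(** Ky Fan's maximum principle.  With [c i] the squared length of the image
    under [Z] of the [i]-th left singular vector, [0 <= c i <= 1] and
    [\sum_i c i = \tr Z <= r], so a weighted sum of the decreasing squared
    singular values with weights [c] is largest when the first [r] weights are 1
    and the others vanish. *)
Lemma ky_fan m n r (h : (r < m)%N) (X : 'M[R]_(m, n)) U s W (Z : 'M[R]_m) :
  is_svd X U s W -> Z^T = Z -> Z *m Z = Z -> \tr Z <= r%:R ->
  frob2 (Z *m X) <= frob2 ((left_frame (ltnW h) U)^T *m X).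
Proof.
move=> svd Zt ZZ trZ; rewrite (frob2_svd_frame _ svd) (frob2_svd _ svd).
have [UU WW s0 smono XE] := svd.
pose c (i : 'I_m) := frob2 (Z *m col i U).
have c1 i : c i <= 1.
  by rewrite -(frob2_orthogonal_col i UU) frob2_projector_le.
have sc : \sum_i c i <= r%:R.
  apply: le_trans trZ; rewrite -[in leRHS]ZZ -{2}Zt -frob2E.
  rewrite -(frob2_tr Z) -(@frob2_isometry _ _ _ _ U^T); last first.
    by rewrite trmxK; exact: mulmx1C.
  rewrite -trmx_mul frob2_tr frob2_col; apply: ler_sum => i _.
  by rewrite /c !colE mulmxA.
have sr : \sum_(i < m) (i < r)%:R = r%:R :> R.
  rewrite -natr_sum; congr _%:R.
  rewrite -[RHS]card_ord -sum1_card (big_ord_widen m (fun=> 1%N)) ?(ltnW h) //.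
  by rewrite [RHS]big_mkcond; apply: eq_bigr => i _; case: ltnP.
set lam := sq_sigma m n s.
rewrite -subr_ge0 -sumrB.
(* Replacing every weight [lam i] by [lam r] only lowers the sum, because
   [(i < r) - c i] is nonnegative for [i < r] and nonpositive afterwards. *)
apply: (@le_trans _ _ (\sum_(i < m) lam r * ((i < r)%:R - c i))).
  by rewrite -mulr_sumr sumrB sr mulr_ge0 ?sq_sigma_ge0 // subr_ge0.
apply: ler_sum => i _; rewrite -mulrBr.
have mono j k : (j <= k)%N -> lam k <= lam j.
  rewrite /lam /sq_sigma => jk; case: ifP => km; last first.
    by case: ifP => _ //; exact: sqr_ge0.
  have jm := leq_ltn_trans jk km; rewrite jm.
  by rewrite ler_sqr ?nnegrE ?s0 // smono // jk.
have [ir|ri] := ltnP i r.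
  by apply: ler_wpM2r; [rewrite subr_ge0|exact/mono/ltnW].
apply: ler_wnM2r; last exact: mono.
by rewrite sub0r oppr_le0 frob2_ge0.
Qed.

End SingularValues.

(** * Cauchy-Schwarz and the spectral norm *)

Section Norms.
Variable R : realType.

Lemma sum_cauchy_schwarz (J : finType) (a b : J -> R) :
  (\sum_j a j * b j) ^+ 2 <= (\sum_j a j ^+ 2) * (\sum_j b j ^+ 2).
Proof.
set t := \sum_j a j * b j; set x := \sum_j a j ^+ 2; set y := \sum_j b j ^+ 2.
(* Lagrange's identity *)
have lagrange : \sum_i \sum_j (a i * b j - a j * b i) ^+ 2
  = x * y + x * y - (t * t + t * t).
  rewrite {1}/x {2}mulrC /t !mulr_suml -!big_split -sumrB.
  apply: eq_bigr => i _ /=; rewrite !mulr_sumr -!big_split -sumrB.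
  by apply: eq_bigr => j _ /=; ring.
have : 0 <= \sum_i \sum_j (a i * b j - a j * b i) ^+ 2.
  by apply: sumr_ge0 => i _; apply: sumr_ge0 => j _; exact: sqr_ge0.
by rewrite lagrange expr2; lra.
Qed.

Lemma tensor_norm_triangle N (d : 'I_N -> nat) (A B : tensor R d) :
  tensor_norm (A + B) <= tensor_norm A + tensor_norm B.
Proof.
rewrite /tensor_norm.
set x := \sum_i A i ^+ 2; set y := \sum_i B i ^+ 2.
have x0 : 0 <= x by apply: sumr_ge0 => i _; exact: sqr_ge0.
have y0 : 0 <= y by apply: sumr_ge0 => i _; exact: sqr_ge0.
have -> : \sum_i (A + B) i ^+ 2 = x + y + (\sum_i A i * B i) *+ 2.
  rewrite -sumrMnl -!big_split; apply: eq_bigr => i _ /=.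
  by rewrite ffunE; ring.
rewrite -[leRHS]ger0_norm ?addr_ge0 ?sqrtr_ge0 // -sqrtr_sqr.
rewrite ler_sqrt ?sqr_ge0 //.
rewrite sqrrD !sqr_sqrtr // [leRHS]addrAC lerD2l lerMn2r /= -sqrtrM //.
rewrite (le_trans (ler_norm _)) // -sqrtr_sqr ler_sqrt ?mulr_ge0 //.
exact: sum_cauchy_schwarz.
Qed.

Lemma vec_norm2E n (v : 'cV[R]_n) : vec_norm2 v = Num.sqrt (frob2 v).
Proof. by congr Num.sqrt; apply: eq_bigr => i _; rewrite big_ord1. Qed.

Lemma frob2_mul_le m n (A : 'M[R]_(m, n)) (v : 'cV[R]_n) :
  frob2 (A *m v) <= frob2 A * frob2 v.
Proof.
rewrite {1 2}/frob2 mulr_suml; apply: ler_sum => i _.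
rewrite big_ord1 mxE (le_trans (sum_cauchy_schwarz _ _)) //.
by rewrite /frob2; under [X in _ <= _ * X]eq_bigr do rewrite big_ord1.
Qed.

(** The supremum in [spectral_norm] is over a set bounded by the Frobenius
    norm, so it is an upper bound of that set. *)
Lemma spectral_norm_unit m n (A : 'M[R]_(m, n)) (v : 'cV[R]_n) :
  vec_norm2 v <= 1 -> vec_norm2 (A *m v) <= spectral_norm A.
Proof.
move=> v1; apply: ub_le_sup; last by exists v.
exists (Num.sqrt (frob2 A)) => _ [u u1 <-].
rewrite vec_norm2E ler_sqrt ?frob2_ge0 // (le_trans (frob2_mul_le _ _)) //.
move: u1; rewrite /= vec_norm2E -[leRHS]sqrtr1 ler_sqrt // => u1.
by rewrite ler_piMr ?frob2_ge0.
Qed.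

Lemma spectral_norm_ge0 m n (A : 'M[R]_(m, n)) : 0 <= spectral_norm A.
Proof.
apply: (@le_trans _ _ (vec_norm2 (A *m 0))); first exact: sqrtr_ge0.
apply: spectral_norm_unit; rewrite vec_norm2E /frob2 big1 ?sqrtr0 // => i _.
by rewrite big_ord1 mxE expr0n.
Qed.

Lemma frob2Z m n (c : R) (X : 'M[R]_(m, n)) :
  frob2 (c *: X) = c ^+ 2 * frob2 X.
Proof.
rewrite /frob2 mulr_sumr; apply: eq_bigr => i _.
by rewrite mulr_sumr; apply: eq_bigr => j _; rewrite mxE exprMn.
Qed.

Lemma frob2_spectral_norm m n p (A : 'M[R]_(m, n)) (X : 'M[R]_(n, p)) :
  frob2 (A *m X) <= spectral_norm A ^+ 2 * frob2 X.
Proof.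
rewrite !frob2_col mulr_sumr; apply: ler_sum => j _.
rewrite colE -mulmxA -colE; move: (col j X) => v {X j}.
have [v0|v0] := eqVneq (frob2 v) 0.
  by rewrite (le_trans (frob2_mul_le _ _)) // v0 !mulr0.
pose c := (Num.sqrt (frob2 v))^-1.
have c2 : c ^+ 2 = (frob2 v)^-1 by rewrite exprVn sqr_sqrtr ?frob2_ge0.
have := @spectral_norm_unit _ _ A (c *: v).
rewrite vec_norm2E frob2Z c2 mulVf // sqrtr1 => /(_ (lexx _)).
rewrite -scalemxAr vec_norm2E frob2Z c2 => h.
have vp : 0 < frob2 v by rewrite lt_neqAle eq_sym v0 frob2_ge0.
rewrite -ler_pdivrMr // mulrC -(@sqr_sqrtr _ (_ * _)); last first.
  by rewrite mulr_ge0 ?frob2_ge0 // invr_ge0 frob2_ge0.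
by rewrite ler_sqr ?nnegrE ?sqrtr_ge0 ?spectral_norm_ge0.
Qed.

End Norms.

(** * Unfoldings and multilinear products *)

Section UnfoldingBijection.
Variables (N : nat) (d : 'I_N -> nat) (n : 'I_N).

Lemma unfold_index_row i j : @unfold_index N d n i j n = i.
Proof. by apply: val_inj; rewrite ffunE /= /unfold_nat eqxx. Qed.

(** Mixed radix: the digits of the modes below [t] determine the column index
    modulo the product of their dimensions, by induction on [t]. *)
Lemma unfold_digits_inj (j j' : 'I_(unfold_cols d n)) :
  (forall m, m != n -> (j %/ unfold_stride d n m) %% d m
                       = (j' %/ unfold_stride d n m) %% d m)%N -> j = j'.
Proof.
move=> digits; apply: val_inj => /=.
pose stride t := (\prod_(k < N | (k < t)%N && (k != n)) d k)%N.
suff: (j %% stride N = j' %% stride N)%N.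
  have -> : stride N = unfold_cols d n by apply: eq_bigl => k; rewrite ltn_ord.
  by rewrite !modn_small.
suff H t : (t <= N)%N -> (j %% stride t = j' %% stride t)%N by exact: H.
elim: t => [_|t IH tN].
  by rewrite /stride big_pred0 ?modn1 // => k.
pose m := Ordinal tN; have {IH} IH := IH (ltnW tN).
have [mn|mn] := eqVneq m n.
  have -> // : stride t.+1 = stride t.
  apply: eq_bigl => k; rewrite ltnS leq_eqVlt andb_orl.
  by rewrite (_ : (k == t :> nat) = (k == n)) ?andbN // -mn.
have strideS : stride t.+1 = (d m * stride t)%N.
  rewrite /stride (bigD1 m) /=; last by rewrite ltnSn mn.
  congr muln; apply: eq_bigl => k.
  rewrite ltnS -(val_eqE k m) /= [in RHS]ltn_neqAle. by rewrite andbC andbA.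
have digit (x : nat) :
    (x %% stride t.+1 = ((x %/ stride t) %% d m) * stride t + x %% stride t)%N.
  rewrite modn_divl strideS {1}(divn_eq (x %% (d m * stride t)) (stride t)).
  by rewrite modn_dvdm // dvdn_mull.
by rewrite !digit IH; congr (_ * _ + _)%N; exact: digits.
Qed.

Lemma unfold_index_col_inj (i i' : 'I_(d n)) (j j' : 'I_(unfold_cols d n)) :
  (forall m, m != n -> unfold_index i j m = unfold_index i' j' m) -> j = j'.
Proof.
move=> E; apply: unfold_digits_inj => m mn.
have := congr1 val (E m mn).
by rewrite !ffunE /= /unfold_nat (negPf mn).
Qed.

Lemma card_multi_index : #|{: multi_index d}| = (\prod_m d m)%N.
Proof.
rewrite -(bij_eq_card (dffun_of_fprod_bij (fun m => 'I_(d m)))) card_fprod.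
by apply: eq_bigr => m _; rewrite card_ord.
Qed.

Lemma unfold_index_bij :
  bijective (fun p : 'I_(d n) * 'I_(unfold_cols d n) => unfold_index p.1 p.2).
Proof.
apply: inj_card_bij => [[i j] [i' j'] /= E|].
  have ij m : unfold_index i j m = unfold_index i' j' m by rewrite E.
  congr pair; last by apply: unfold_index_col_inj => m _; exact: ij.
  by rewrite -(unfold_index_row i j) -(unfold_index_row i' j').
by rewrite card_multi_index card_prod !card_ord (bigD1 n).
Qed.

Lemma sum_unfold (R : realType) (F : multi_index d -> R) :
  \sum_k F k = \sum_i \sum_j F (@unfold_index N d n i j).
Proof.
by rewrite (reindex _ (onW_bij _ unfold_index_bij)) pair_bigA.
Qed.

End UnfoldingBijection.

Section Multilinear.
Variables (R : realType) (N : nat).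
Implicit Types d : 'I_N -> nat.

Definition tensor_dot d (A B : tensor R d) : R := \sum_i A i * B i.

Definition tensor_ssq d (A : tensor R d) : R := \sum_i A i ^+ 2.

(** The tensor [A x_0 B_0 ... x_(N-1) B_(N-1)] in closed form, with no
    intermediate dimensions.  It composes and transposes factor by factor
    ([multilinM], [multilin_adjoint]); the iterated products of the algorithm
    are reduced to it by [mode_products_multilin] and [tucker_multilin]. *)
Definition multilin d d' (A : tensor R d) (B : forall n, 'M[R]_(d' n, d n)) :
    tensor R d' :=
  [ffun i : multi_index d' =>
     \sum_(k : multi_index d) (\prod_n B n (i n) (k n)) * A k].

(** The finite-choice form of distributivity, for factors indexed by different
    types. *)
Lemma prod_sum_multi_index d (F : forall n, 'I_(d n) -> R) :
  \prod_n \sum_k F n k = \sum_(k : multi_index d) \prod_n F n (k n).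
Proof.
pose T n := 'I_(d n) : finType.
rewrite (reindex _ (onW_bij _ (dffun_of_fprod_bij T))) /=.
transitivity (\sum_(t : fprod T) \prod_(n in 'I_N) [ffun k => F n k] (t n)).
  rewrite (big_fprod _ _ (fun n : 'I_N => [ffun k : T n => F n k])).
  rewrite -(bigA_distr_big_dep (fun n : 'I_N => [in tagged_with T n])
    (fun n x => untag 0 [ffun k : T n => F n k] x)).
  apply: eq_bigr => n _.
  rewrite -(big_tag (fun n => [ffun k : T n => F n k] : T n -> R) n).
  by apply: eq_bigr => k _; rewrite ffunE.
by apply: eq_bigr => t _; apply: eq_bigr => n _; rewrite !ffunE.
Qed.

Lemma multilinM d1 d2 d3 (A : tensor R d1) (B : forall n, 'M[R]_(d2 n, d1 n))
    (C : forall n, 'M[R]_(d3 n, d2 n)) :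
  multilin (multilin A B) C = multilin A (fun n => C n *m B n).
Proof.
apply/ffunP => i; rewrite !ffunE.
under eq_bigr do rewrite ffunE mulr_sumr.
rewrite exchange_big; apply: eq_bigr => l _ /=.
transitivity (\sum_(k : multi_index d2)
  (\prod_n (C n (i n) (k n) * B n (k n) (l n))) * A l).
  by apply: eq_bigr => k _; rewrite mulrA -big_split.
rewrite -mulr_suml; congr (_ * _).
rewrite -(prod_sum_multi_index (fun n k => C n (i n) k * B n k (l n))).
by apply: eq_bigr => n _; rewrite mxE.
Qed.

Lemma eq_multilin d d' (A : tensor R d) (B C : forall n, 'M[R]_(d' n, d n)) :
  (forall n, B n = C n) -> multilin A B = multilin A C.
Proof.
move=> BC; apply/ffunP => i; rewrite !ffunE; apply: eq_bigr => k _.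
by congr (_ * _); apply: eq_bigr => n _; rewrite BC.
Qed.

Lemma multilin_pick d d' (A : tensor R d) (B : forall n, 'M[R]_(d' n, d n))
    (i : multi_index d') (k : multi_index d) :
  (forall n l, B n (i n) l = (l == k n)%:R) -> multilin A B i = A k.
Proof.
move=> Bi; rewrite ffunE (bigD1 k) //= [X in X * _]big1 ?mul1r; last first.
  by move=> n _; rewrite Bi eqxx.
rewrite big1 ?addr0 // => l /eqP lk.
have [n ln] : exists n, l n != k n.
  apply/existsP; rewrite -negb_forall; apply/forallP => E.
  by apply: lk; apply/ffunP => n; exact/eqP/E.
by rewrite (bigD1 n) //= Bi (negPf ln) !mul0r.
Qed.

Lemma multilin1 d (A : tensor R d) : multilin A (fun n => 1%:M) = A.
Proof.
by apply/ffunP => i; apply: multilin_pick => n l; rewrite mxE eq_sym.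
Qed.

Lemma multilinB d d' (A C : tensor R d) (B : forall n, 'M[R]_(d' n, d n)) :
  multilin (A - C) B = multilin A B - multilin C B.
Proof.
apply/ffunP => i; rewrite !ffunE -sumrB; apply: eq_bigr => k _.
by rewrite !ffunE mulrBr.
Qed.

Lemma multilin_adjoint d d' (A : tensor R d) (C : tensor R d')
    (B : forall n, 'M[R]_(d' n, d n)) :
  tensor_dot (multilin A B) C = tensor_dot A (multilin C (fun n => (B n)^T)).
Proof.
rewrite /tensor_dot; under eq_bigr do rewrite ffunE mulr_suml.
rewrite exchange_big; apply: eq_bigr => k _; rewrite ffunE mulr_sumr.
apply: eq_bigr => i _; rewrite mulrAC mulrC; congr (_ * (_ * _)).
by apply: eq_bigr => n _; rewrite mxE.
Qed.

Lemma tensor_ssqE d (A : tensor R d) : tensor_ssq A = tensor_dot A A.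
Proof. by apply: eq_bigr => i _; rewrite expr2. Qed.

Lemma tensor_ssq_unfolding d (n : 'I_N) (A : tensor R d) :
  tensor_ssq A = frob2 (unfolding n A).
Proof.
rewrite /tensor_ssq (sum_unfold n); apply: eq_bigr => i _.
by apply: eq_bigr => j _; rewrite mxE.
Qed.

Lemma tensor_dot_unfolding d (n : 'I_N) (A B : tensor R d) :
  tensor_dot A B = \tr (unfolding n A *m (unfolding n B)^T).
Proof.
rewrite /tensor_dot (sum_unfold n); apply: eq_bigr => i _.
by rewrite mxE; apply: eq_bigr => j _; rewrite !mxE.
Qed.

(** As factors of [multilin]: [P] acts on mode [n] and the other modes are left
    alone. *)
Definition on_mode d (n : 'I_N) (P : 'M[R]_(d n)) (m : 'I_N) : 'M[R]_(d m) :=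
  eqtype.dfwith (T := fun m => 'M[R]_(d m)) (fun m => 1%:M) P m.

Lemma on_mode_in d (n : 'I_N) (P : 'M[R]_(d n)) : on_mode P n = P.
Proof. exact: eqtype.dfwith_in. Qed.

Lemma on_mode_out d (n m : 'I_N) (P : 'M[R]_(d n)) :
  m != n -> on_mode P m = 1%:M.
Proof. by rewrite eq_sym => nm; rewrite /on_mode eqtype.dfwith_out. Qed.

Lemma unfolding_on_mode d (n : 'I_N) (A : tensor R d) (P : 'M[R]_(d n)) :
  unfolding n (multilin A (on_mode P)) = P *m unfolding n A.
Proof.
apply/matrixP => i j; rewrite !mxE ffunE (sum_unfold n).
apply: eq_bigr => i' _; rewrite (bigD1 j) //= [X in _ + X]big1 => [|j' jj'].
  rewrite addr0 mxE (bigD1 n) //= on_mode_in !unfold_index_row.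
  rewrite big1 ?mulr1 // => m mn; rewrite on_mode_out // mxE.
  by rewrite (_ : unfold_index i j m == _) //; apply/eqP/val_inj;
    rewrite !ffunE /= /unfold_nat (negPf mn).
have [m mn Em] : exists2 m, m != n & unfold_index i j m != unfold_index i' j' m.
  apply/exists_inP; rewrite -negb_forall_in; apply: contra jj' => /forall_inP E.
  by apply/eqP/esym/(@unfold_index_col_inj _ _ _ i i') => m /E /eqP.
by rewrite (bigD1 m) //= on_mode_out // mxE (negPf Em) !mul0r.
Qed.

End Multilinear.

(** * Mode products in closed form *)

Section ModeProducts.
Variables (R : realType) (N : nat).
Implicit Types d : 'I_N -> nat.

Lemma ltnS_neq i k : i != k -> (i < k.+1)%N = (i < k)%N.
Proof. by rewrite ltnS leq_eqVlt => /negPf ->. Qed.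

(** Dimensions such as [mid_dims d d' k n] and [d' n] are equal without being
    convertible.  Reading entries at natural numbers makes the casts between
    them disappear ([nat_entry_castmx]). *)
Definition nat_entry p q (B : 'M[R]_(p, q)) (i j : nat) : R :=
  if insub i is Some a then if insub j is Some b then B a b else 0 else 0.

Lemma nat_entry_ord p q (B : 'M[R]_(p, q)) (i : 'I_p) (j : 'I_q) :
  nat_entry B i j = B i j.
Proof. by rewrite /nat_entry !valK. Qed.

Lemma nat_entry_castmx p q p' q' (e : (p = p') * (q = q')) (B : 'M[R]_(p, q))
    (i j : nat) : nat_entry (castmx e B) i j = nat_entry B i j.
Proof. by case: e => e1 e2; case: _ / e1; case: _ / e2; rewrite castmx_id. Qed.

Lemma sum_nat_delta p i (F : nat -> R) :
  (i < p)%N -> \sum_(l < p) (i == l)%:R * F l = F i.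
Proof.
move=> ip; rewrite (bigD1 (Ordinal ip)) //= eqxx mul1r big1 ?addr0 // => l.
by rewrite -val_eqE /= eq_sym => /negPf ->; rewrite mul0r.
Qed.

(** The factors of a single mode product seen as a multilinear product.  When
    the dimensions agree outside mode [n], the other factors are identities, up
    to a cast. *)
Definition mode_mx d d' (n : 'I_N) (B : 'M[R]_(d' n, d n)) (m : 'I_N) :
    'M[R]_(d' m, d m) :=
  \matrix_(i, j) if m == n then nat_entry B i j else (i == j :> nat)%:R.

Lemma mode_mx_in d d' (n : 'I_N) (B : 'M[R]_(d' n, d n)) : mode_mx B n = B.
Proof. by apply/matrixP => i j; rewrite mxE eqxx nat_entry_ord. Qed.

Lemma mode_product_multilin d d' (n : 'I_N) (A : tensor R d)
    (B : 'M[R]_(d' n, d n)) : mode_product A B = multilin A (mode_mx B).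
Proof.
apply/ffunP => i; rewrite !ffunE big_mkcond; apply: eq_bigr => k _ /=.
rewrite (bigD1 n) //= mode_mx_in; case: ifP => [/forallP agree|/negbT].
  rewrite big1 ?mulr1 // => m mn; rewrite mxE (negPf mn) eq_sym.
  by have := implyP (agree m) mn => ->.
rewrite negb_forall => /existsP [m]; rewrite negb_imply => /andP[mn km].
by rewrite (bigD1 m) //= mxE (negPf mn) eq_sym (negPf km) mul0r mulr0 mul0r.
Qed.

(** By adjunction the norm of the image depends only on the Gram matrices of
    the factors; these live in the dimensions of [A], so images in unrelated
    dimensions can be compared. *)
Lemma tensor_ssq_multilin d d' (A : tensor R d)
    (B : forall n, 'M[R]_(d' n, d n)) :
  tensor_ssq (multilin A B)
    = tensor_dot A (multilin A (fun n => (B n)^T *m B n)).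
Proof. by rewrite tensor_ssqE multilin_adjoint multilinM. Qed.

Lemma tensor_ssq_isometry d d' (A : tensor R d)
    (B : forall n, 'M[R]_(d' n, d n)) :
  (forall n, (B n)^T *m B n = 1%:M) ->
  tensor_ssq (multilin A B) = tensor_ssq A.
Proof.
move=> BB; rewrite tensor_ssq_multilin (eq_multilin A BB) multilin1.
by rewrite tensor_ssqE.
Qed.

Lemma mode_mx_gram d d' (n m : 'I_N) (B : 'M[R]_(d' n, d n)) :
  (forall m, m != n -> d m = d' m) ->
  (mode_mx B m)^T *m mode_mx B m = on_mode (B^T *m B) m.
Proof.
move=> dd; have [->|mn] := eqVneq m n; first by rewrite mode_mx_in on_mode_in.
rewrite on_mode_out //; apply/matrixP => i j; rewrite !mxE.
under eq_bigr do rewrite !mxE (negPf mn) (eq_sym _ (val i)).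
rewrite (sum_nat_delta (fun l => (l == j)%:R)) //.
by rewrite -dd //; exact: ltn_ord.
Qed.

Lemma tensor_ssq_mode_product d d' (n : 'I_N) (A : tensor R d)
    (B : 'M[R]_(d' n, d n)) :
  (forall m, m != n -> d m = d' m) ->
  tensor_ssq (mode_product A B) = frob2 (B *m unfolding n A).
Proof.
move=> dd; rewrite mode_product_multilin tensor_ssq_multilin.
rewrite (eq_multilin A (fun m => mode_mx_gram m B dd)).
rewrite (tensor_dot_unfolding n) unfolding_on_mode frob2E.
by rewrite !trmx_mul trmxK !mulmxA mxtrace_mulC !mulmxA.
Qed.

Lemma tensor_ssq_mode_product_step d d' (n : 'I_N)
    (A : tensor R (mid_dims d d' n)) (B : 'M[R]_(d' n, d n)) :
  tensor_ssq (mode_product_step A B)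
    = frob2 (castmx (esym (mid_dims_after d d' n),
                     esym (mid_dims_before d d' n)) B *m unfolding n A).
Proof.
apply: tensor_ssq_mode_product => m mn.
by rewrite /mid_dims ltnS_neq.
Qed.

(** The factors accumulated once the modes below [k] have been processed. *)
Definition mid_mx d d' (B : forall n, 'M[R]_(d' n, d n)) (k : nat) (m : 'I_N) :
    'M[R]_(mid_dims d d' k m, d m) :=
  \matrix_(i, j) if (m < k)%N then nat_entry (B m) i j else (i == j :> nat)%:R.

Lemma mode_productsS d d' (A : tensor R d) (B : forall n, 'M[R]_(d' n, d n))
    (n : 'I_N) :
  mode_products A B n.+1 = mode_product_step (mode_products A B n) (B n).
Proof.
case: n => k kN /=; case: {-}_ / idP => // kN'.
by rewrite (bool_irrelevance kN' kN).
Qed.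

Lemma tensor_ssq_mode_productsS d d' (A : tensor R d)
    (B : forall n, 'M[R]_(d' n, d n)) (n : 'I_N) :
  tensor_ssq (mode_products A B n.+1)
    = frob2 (castmx (esym (mid_dims_after d d' n),
                     esym (mid_dims_before d d' n)) (B n)
             *m unfolding n (mode_products A B n)).
Proof. by rewrite mode_productsS tensor_ssq_mode_product_step. Qed.

Lemma mode_products_multilin d d' (A : tensor R d)
    (B : forall n, 'M[R]_(d' n, d n)) (k : nat) :
  (k <= N)%N -> mode_products A B k = multilin A (mid_mx B k).
Proof.
elim: k => [_|k IH kN].
  apply/ffunP => i; apply/esym/multilin_pick => n l.
  by rewrite mxE /= eq_sym -val_eqE.
pose n := Ordinal kN; rewrite (mode_productsS A B n) /=.
rewrite /mode_product_step mode_product_multilin (IH (ltnW kN)) multilinM.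
apply: eq_multilin => m; apply/matrixP => i j; rewrite !mxE.
have [mn|mn] := eqVneq m n.
  subst m; rewrite ltnS leqnn.
  under eq_bigr do rewrite !mxE eqxx ltnn nat_entry_castmx mulrC eq_sym.
  rewrite (sum_nat_delta (fun l => nat_entry (B n) i l)) //.
  by rewrite mid_dims_before.
under eq_bigr do rewrite !mxE (negPf mn).
rewrite (sum_nat_delta (fun l => if (m < k)%N then nat_entry (B m) l j
  else (l == j)%:R)).
  by rewrite ltnS_neq.
by have := ltn_ord i; rewrite {2}/mid_dims ltnS_neq.
Qed.

Lemma tucker_multilin d d' (A : tensor R d) (B : forall n, 'M[R]_(d' n, d n)) :
  tucker A B = multilin A B.
Proof.
apply/ffunP => i; rewrite ffunE mode_products_multilin // !ffunE.
apply: eq_bigr => k _; congr (_ * _); apply: eq_bigr => n _.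
by rewrite mxE ltn_ord ffunE /= nat_entry_ord.
Qed.

Lemma tensor_ssq_mode_products_all d d' (A : tensor R d)
    (B : forall n, 'M[R]_(d' n, d n)) :
  tensor_ssq (mode_products A B N) = tensor_ssq (multilin A B).
Proof.
rewrite mode_products_multilin // !tensor_ssq_multilin.
congr tensor_dot; apply: eq_multilin => n; apply/matrixP => i j.
rewrite !mxE.
pose F l := nat_entry (B n) l i * nat_entry (B n) l j.
transitivity (\sum_(l < mid_dims d d' N n) F l).
  by apply: eq_bigr => l _; rewrite !mxE ltn_ord.
rewrite -(big_mkord xpredT F) mid_dims_full big_mkord.
by apply: eq_bigr => l _; rewrite /F !nat_entry_ord mxE.
Qed.

Lemma castmx_mul_le p q p' q' (ep : p = p') (eq : q = q') (B : 'M[R]_(p, q))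
    (c : R) :
  (forall t (X : 'M[R]_(q, t)), frob2 (B *m X) <= c * frob2 X) ->
  forall t (X : 'M[R]_(q', t)), frob2 (castmx (ep, eq) B *m X) <= c * frob2 X.
Proof. by case: _ / ep; case: _ / eq; rewrite castmx_id. Qed.

(** Modes are multiplied one at a time, and one factor acts on the columns of
    an unfolding, so the bounds of the factors multiply. *)
Lemma tensor_ssq_mode_products_le d d' (A : tensor R d)
    (B : forall n, 'M[R]_(d' n, d n)) (c : 'I_N -> R) (k : nat) :
  (forall n, 0 <= c n) ->
  (forall n t (X : 'M[R]_(d n, t)), frob2 (B n *m X) <= c n * frob2 X) ->
  (k <= N)%N ->
  tensor_ssq (mode_products A B k)
    <= (\prod_(n < N | (n < k)%N) c n) * tensor_ssq A.
Proof.
move=> c0 Bc; elim: k => [_|k IH kN]; first by rewrite big_pred0 ?mul1r.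
pose n := Ordinal kN; rewrite (tensor_ssq_mode_productsS A B n).
rewrite (le_trans (castmx_mul_le _ _ (@Bc n) _)) //.
rewrite -tensor_ssq_unfolding (bigD1 n) //= -mulrA ler_wpM2l //.
rewrite (le_trans (IH (ltnW kN))) // (eq_bigl (fun m : 'I_N => m < k)%N) //.
by move=> m; rewrite ltnS -(val_eqE m n) /= andbC -ltn_neqAle.
Qed.

Lemma tensor_ssq_multilin_le d d' (A : tensor R d)
    (B : forall n, 'M[R]_(d' n, d n)) (c : 'I_N -> R) :
  (forall n, 0 <= c n) ->
  (forall n t (X : 'M[R]_(d n, t)), frob2 (B n *m X) <= c n * frob2 X) ->
  tensor_ssq (multilin A B) <= (\prod_n c n) * tensor_ssq A.
Proof.
move=> c0 Bc; rewrite -tensor_ssq_mode_products_all.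
rewrite (le_trans (tensor_ssq_mode_products_le A c0 Bc (leqnn N))) //.
by rewrite [X in X * _](eq_bigl xpredT) // => n; exact: ltn_ord.
Qed.

End ModeProducts.

(** * Sequentially truncated HOSVD *)

Section SequentialTruncation.
Variables (R : realType) (N : nat).
Implicit Types d r s : 'I_N -> nat.

Definition st_core d r (G : tensor R d) (V : forall n, 'M[R]_(d n, r n))
    (k : nat) : tensor R (mid_dims d r k) :=
  mode_products G (fun m => (V m)^T) k.

Lemma st_hosvd_orthonormal d r (G : tensor R d) (S : tensor R r)
    (V : forall n, 'M[R]_(d n, r n)) :
  (forall n, r n <= d n)%N -> st_hosvd G S V ->
  forall n, (V n)^T *m V n = 1%:M.
Proof.
move=> rd [lead _] n; have [U [s [W [[UU _ _ _ _] VU]]]] := lead n.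
have gram p q p' (e : p = p') (X : 'M[R]_(p, q)) :
    (castmx (e, erefl) X)^T *m castmx (e, erefl) X = X^T *m X.
  by case: _ / e; rewrite castmx_id.
have h : (r n <= mid_dims d r n n)%N by rewrite mid_dims_before.
rewrite -(gram _ _ _ (esym (mid_dims_before d r n))).
rewrite -(left_frame_orthonormal h UU); congr (_^T *m _);
  by apply/matrixP => i j; rewrite (VU i j (widen_ord h j)) // mxE.
Qed.

(** The approximation is the orthogonal projection of [G] with core [S], so its
    squared error is the loss of squared norm from [G] to [S], which telescopes
    over the successive cores. *)
Lemma st_hosvd_error d r (G : tensor R d) (S : tensor R r)
    (V : forall n, 'M[R]_(d n, r n)) :
  (forall n, r n <= d n)%N -> st_hosvd G S V ->
  tensor_ssq (multilin S V - G)
    = \sum_(n < N) (tensor_ssq (st_core G V n) - tensor_ssq (st_core G V n.+1)).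
Proof.
set core := st_core G V; move=> rd hSV; have VV := st_hosvd_orthonormal rd hSV.
have SE : S = multilin G (fun m => (V m)^T).
  by case: hSV => _ ->; exact: tucker_multilin.
have -> : \sum_(n < N) (tensor_ssq (core n) - tensor_ssq (core n.+1))
    = tensor_ssq G - tensor_ssq S.
  rewrite SE -tensor_ssq_mode_products_all.
  rewrite -(big_mkord xpredT
    (fun n => tensor_ssq (core n) - tensor_ssq (core n.+1))).
  rewrite -[LHS]opprK -sumrN; under eq_bigr do rewrite opprB.
  by rewrite telescope_sumr // opprB.
have normS : tensor_dot (multilin S V) (multilin S V) = tensor_ssq S.
  by rewrite -tensor_ssqE tensor_ssq_isometry.
have crossS : tensor_dot (multilin S V) G = tensor_ssq S.
  by rewrite multilin_adjoint -SE tensor_ssqE.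
have -> : tensor_ssq (multilin S V - G)
    = tensor_dot (multilin S V) (multilin S V)
    - tensor_dot (multilin S V) G *+ 2 + tensor_ssq G.
  rewrite /tensor_ssq /tensor_dot -sumrMnl -sumrB -big_split.
  by apply: eq_bigr => i _ /=; rewrite !ffunE; ring.
by rewrite normS crossS; ring.
Qed.

Lemma unfoldingB d (n : 'I_N) (A B : tensor R d) :
  unfolding n (A - B) = unfolding n A - unfolding n B.
Proof. by apply/matrixP => i j; rewrite !mxE !ffunE. Qed.

(** The norm lost in one step is that of the tail of the singular values of the
    current unfolding.  By Ky Fan it is at most what the projector [Z] loses,
    hence at most the squared distance to any [Y] whose mode-[n] fibres lie in
    the range of [Z]. *)
Lemma st_hosvd_step_le d r (G : tensor R d) (S : tensor R r)
    (V : forall n, 'M[R]_(d n, r n)) (n : 'I_N) (Z : 'M[R]_(mid_dims d r n n))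
    (Y : tensor R (mid_dims d r n)) :
  (forall n, r n < d n)%N -> st_hosvd G S V ->
  Z^T = Z -> Z *m Z = Z -> \tr Z <= (r n)%:R -> multilin Y (on_mode Z) = Y ->
  tensor_ssq (st_core G V n) - tensor_ssq (st_core G V n.+1)
    <= tensor_ssq (st_core G V n - Y).
Proof.
move=> rd [lead _] Zt ZZ trZ ZY; set core := st_core G V.
have [U [s [W [svd VU]]]] := lead n.
have h : (r n < mid_dims d r n n)%N by rewrite mid_dims_before.
have VE : castmx (esym (mid_dims_before d r n), erefl) (V n)
    = left_frame (ltnW h) U.
  by apply/matrixP => i j; rewrite (VU i j (widen_ord (ltnW h) j)) // mxE.
have transpose p q p' q' t (ep : p = p') (eq : q = q') (X : 'M[R]_(p, q))
    (M : 'M[R]_(p', t)) :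
    frob2 (castmx (eq, ep) X^T *m M) = frob2 ((castmx (ep, erefl) X)^T *m M).
  by move: M; case: _ / ep; case: _ / eq => M; rewrite !castmx_id.
rewrite [tensor_ssq (core n.+1)]tensor_ssq_mode_productsS -/core transpose VE.
apply: (@le_trans _ _ (frob2 (unfolding n (core n))
    - frob2 (Z *m unfolding n (core n)))).
  by rewrite (tensor_ssq_unfolding n) lerD2l lerN2; exact: ky_fan svd _ _ _.
rewrite (tensor_ssq_unfolding n) unfoldingB.
by apply: frob2_residual_le => //; rewrite -unfolding_on_mode ZY.
Qed.

End SequentialTruncation.

(** * Images under bounded factors *)

Section Conversion.
Variables (R : realType) (N : nat).
Implicit Types d r s : 'I_N -> nat.

(** The core at step [n] is the image of [A] under a multilinear map whose
    squared norm is at most [\prod_n c n].  The competitor [Y] is the image under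
    the same map of the best approximation of [A] with mode-[n] rank [r n]: its
    mode-[n] rank is still at most [r n], and its squared distance to the core is
    at most [\prod_n c n] times the tail of the squared singular values of
    [unfolding n A]. *)
Lemma st_hosvd_image_error d s r (A : tensor R d)
    (B : forall n, 'M[R]_(s n, d n)) (c : 'I_N -> R)
    (S : tensor R r) (V : forall n, 'M[R]_(s n, r n))
    (sigma : 'I_N -> nat -> R) :
  (forall n, 0 <= c n) ->
  (forall n t (X : 'M[R]_(d n, t)), frob2 (B n *m X) <= c n * frob2 X) ->
  (forall n, r n < s n)%N -> (forall n, r n <= d n)%N ->
  (forall n, singular_values (unfolding n A) (sigma n)) ->
  st_hosvd (multilin A B) S V ->
  tensor_ssq (multilin S V - multilin A B)
    <= (\prod_n c n) * \sum_n \sum_(r n <= i < minn (d n) (unfold_cols d n))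
                                 sigma n i ^+ 2.
Proof.
move=> c0 Bc rs rd hsigma hSV; rewrite (st_hosvd_error _ hSV); last first.
  by move=> n; exact: ltnW.
rewrite mulr_sumr; apply: ler_sum => n _.
have [U [W svd]] := hsigma n.
(* [P] projects on the leading left singular vectors of [unfolding n A]. *)
pose L := left_frame (rd n) U; pose P : 'M[R]_(d n) := L *m L^T.
pose K := mid_mx (fun m => (V m)^T) n.
have GE (C : tensor R d) :
    mode_products (multilin C B) (fun m => (V m)^T) n
      = multilin C (fun m => K m *m B m).
  by rewrite mode_products_multilin ?multilinM // ltnW.
pose Y := multilin (multilin A (on_mode P)) (fun m => K m *m B m).
have [Z [Zt ZZ ZL trZ]] := range_projector (K n *m B n *m L).
have ZY : multilin Y (on_mode Z) = Y.
  rewrite /Y !multilinM; apply: eq_multilin => m.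
  have [->|mn] := eqVneq m n; last by rewrite (on_mode_out Z mn) mul1mx.
  rewrite !on_mode_in /P; move: (K n *m B n) ZL => KB ZL.
  by rewrite -mulmxA (mulmxA KB) mulmxA ZL.
apply: (le_trans (st_hosvd_step_le rs hSV Zt ZZ trZ ZY)).
rewrite /st_core GE /Y -multilinB -GE.
apply: (le_trans
  (tensor_ssq_mode_products_le _ (fun=> ler01) _ (ltnW (ltn_ord n)))).
  move=> m t X; rewrite mul1r; apply: frob2_coisometry_le.
  by apply: (st_hosvd_orthonormal _ hSV) => k; exact: ltnW.
rewrite big1 // mul1r (le_trans (tensor_ssq_multilin_le _ c0 Bc)) //.
rewrite ler_wpM2l ?prodr_ge0 // (tensor_ssq_unfolding n) unfoldingB.
by rewrite unfolding_on_mode (svd_tail (rd n) svd).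
Qed.

End Conversion.

Section Selection.
Variables (R : realType) (N : nat) (d : 'I_N -> nat).

Definition selection_mx (I : forall n, {set 'I_(d n)}) (n : 'I_N) :
    'M[R]_(#|I n|, d n) := \matrix_(i, j) (enum_val i == j)%:R.

Lemma subtensor_multilin (A : tensor R d) (I : forall n, {set 'I_(d n)}) :
  subtensor A I = multilin A (selection_mx I).
Proof.
apply/ffunP => i; rewrite ffunE; apply/esym/multilin_pick => n l.
by rewrite mxE ffunE eq_sym.
Qed.

(** The rows of a selection are distinct unit vectors, so its transpose has
    orthonormal columns. *)
Lemma selection_mx_le (I : forall n, {set 'I_(d n)}) n t (X : 'M[R]_(d n, t)) :
  frob2 (selection_mx I n *m X) <= frob2 X.
Proof.
rewrite -[selection_mx I n]trmxK; apply: frob2_coisometry_le.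
rewrite trmxK; apply/matrixP => i j; rewrite !mxE (bigD1 (enum_val i)) //=.
rewrite !mxE eqxx mul1r (inj_eq enum_val_inj) big1 ?addr0 1?eq_sym // => k ki.
by rewrite !mxE eq_sym (negPf ki) mul0r.
Qed.

End Selection.

Theorem theoremA1 (R : realType) (N : nat)
  (* hyperinterpolation data *)
  (f : 'rV[R]_N -> R)
  (w : 'I_N -> R -> R) (Phi : 'I_N -> nat -> {poly R})
  (I M : 'I_N -> nat) (x q : forall n : 'I_N, 'I_(M n) -> R)
  (hw : forall n, weight_function (w n))
  (hPhi : forall n, orthonormal_polys (w n) (Phi n))
  (hxq : forall n, quadrature_rule (w n) (2 * I n) (x n) (q n))
  (A : tensor R (fun n => (I n).+1))
  (hA : A = hyperinterpolation_coeffs I f Phi x q)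
  (* TCUR approximation *)
  (II : forall n : 'I_N, {set 'I_(I n).+1})
  (JJ : forall n : 'I_N, {set 'I_(unfold_cols (fun m => (I m).+1) n)})
  (hII : forall n, (#|II n| < (I n).+1)%N)
  (hJJ : forall n, (#|JJ n| < unfold_cols (fun m => (I m).+1) n)%N)
  (Upinv : forall n : 'I_N, 'M[R]_(#|JJ n|, #|II n|))
  (hUpinv : forall n, moore_penrose (tcur_U A II JJ n) (Upinv n))
  (CU : forall n : 'I_N, 'M[R]_((I n).+1, #|II n|))
  (hCU : forall n, CU n = tcur_C A JJ n *m Upinv n)
  (A_TCUR : tensor R (fun n => (I n).+1))
  (hA_TCUR : A_TCUR = tucker (subtensor A II) CU)
  (* conversion to Tucker format *)
  (r : 'I_N -> nat) (hr : forall n, (r n < #|II n|)%N)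
  (S : tensor R r) (V : forall n : 'I_N, 'M[R]_((I n).+1, r n))
  (hSV : tcur_to_tucker (subtensor A II) CU S V)
  (* singular values of the unfoldings *)
  (sigma : 'I_N -> nat -> R)
  (hsigma : forall n, singular_values (unfolding n A) (sigma n)) :
  tensor_norm (tucker S V - A) <=
    tensor_norm (A_TCUR - A)
    + (\prod_n spectral_norm (CU n))
      * Num.sqrt (\sum_n
          \sum_(r n <= i < minn (I n).+1 (\prod_(m < N | m != n) (I m).+1))
             sigma n i ^+ 2).
Proof.
have -> : tucker S V - A = (A_TCUR - A) + (tucker S V - A_TCUR).
  by rewrite [RHS]addrC addrA subrK.
apply: (le_trans (tensor_norm_triangle _ _)); rewrite lerD2l.
case: hSV => Q [T [V' [qr hosvd VE]]].
have QQ n : (Q n)^T *m Q n = 1%:M by case: (qr n).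
have CUE n : CU n = Q n *m T n by case: (qr n).
(* Selecting the entries of the subtensor is one more contraction, which makes
   the input [G x T] of the truncation an image of [A]. *)
pose B n := T n *m selection_mx R II n.
have GE : tucker (subtensor A II) T = multilin A B.
  by rewrite tucker_multilin subtensor_multilin multilinM.
have Bc n t (X : 'M[R]_((I n).+1, t)) :
    frob2 (B n *m X) <= spectral_norm (CU n) ^+ 2 * frob2 X.
  rewrite -mulmxA -(frob2_isometry _ (QQ n)) mulmxA -CUE.
  rewrite (le_trans (frob2_spectral_norm _ _)) // ler_wpM2l ?sqr_ge0 //.
  exact: selection_mx_le.
rewrite GE in hosvd.
have rd n : (r n <= (I n).+1)%N.
  by rewrite ltnW // (ltn_trans (hr n)).
have bound := st_hosvd_image_error (fun n => sqr_ge0 _) Bc hr rd hsigma hosvd.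
have -> : tucker S V - A_TCUR = multilin (multilin S V' - multilin A B) Q.
  rewrite hA_TCUR !tucker_multilin multilinB -GE tucker_multilin !multilinM.
  by congr (_ - _); apply: eq_multilin => n; rewrite -?VE -?CUE.
have spec0 : 0 <= \prod_n spectral_norm (CU n).
  by rewrite prodr_ge0 // => n _; exact: spectral_norm_ge0.
rewrite -[X in X * _]ger0_norm // -sqrtr_sqr -sqrtrM ?sqr_ge0 //.
apply: ler_wsqrtr; rewrite -prodrXl; apply: le_trans bound.
by rewrite -(tensor_ssq_isometry (multilin S V' - multilin A B) QQ) lexx.
Qed.
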